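(* Suppose that $G$ is a triangle-free $3$-connected graph with a $3$-connected simple minor $H$, where $|H|\ge 1$. Then $G$ has a forest (as a subgraph) with $|G|-|H|$ edges, each of which is $H$-contractible in $G$.
   Context: Graphs are finite and may have loops and parallel edges; $|G|$ denotes the number of vertices of $G$. A graph is $k$-connected if the removal of each set of fewer than $k$ vertices leaves a connected graph; it is not required that $|G|>k$, and the null graph counts as connected. An $H$-minor of a graph is a minor isomorphic to $H$. For a $3$-connected graph $G$ with a simple $H$-minor, an edge $e$ of $G$ is $H$-contractible if $G/e$ is $3$-connected and has an $H$-minor. *)

(* Defs.v *)
From HB Require Import structures.
From mathcomp Require Import all_boot.

Set Implicit Arguments.
Unset Strict Implicit.
Unset Printing Implicit Defensive.

(* Finite undirected graphs, with loops and parallel edges allowed.  The two    *)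
(* ends of an edge come in an arbitrary order, which no notion below (adjacency, *)
(* isomorphism, cycles, ...) depends on.                                         *)
Record mgraph := MGraph {
  vertex : finType;
  edge : finType;
  src : edge -> vertex;
  tgt : edge -> vertex
}.

Definition nb_vertices (G : mgraph) : nat := #|vertex G|.

Definition joins (G : mgraph) (e : edge G) (x y : vertex G) : bool :=
  ((src e == x) && (tgt e == y)) || ((src e == y) && (tgt e == x)).

Definition adjacent (G : mgraph) : rel (vertex G) :=
  fun x y => [exists e, joins e x y].

Definition simple_graph (G : mgraph) : Prop :=
  (forall e : edge G, src e != tgt e) /\
  (forall (e f : edge G) (x y : vertex G), joins e x y -> joins f x y -> e = f).

Definition isomorphic (G1 G2 : mgraph) : Prop :=
  exists (f : vertex G1 -> vertex G2) (g : edge G1 -> edge G2),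
    [/\ bijective f, bijective g
      & forall e : edge G1, joins (g e) (f (src e)) (f (tgt e))].

(* An edge of F is kept only if both its ends lie in W.  As W and F vary, the    *)
(* graphs subgraph W F are exactly the subgraphs of G.                           *)
Section Subgraph.
Variables (G : mgraph) (W : {set vertex G}) (F : {set edge G}).

Definition sub_vertex : finType := {x : vertex G | x \in W}.

Definition sub_edge : finType :=
  {f : edge G | [&& f \in F, src f \in W & tgt f \in W]}.

Lemma sub_src_subproof (f : sub_edge) : src (val f) \in W.
Proof. by case/and3P: (valP f). Qed.

Lemma sub_tgt_subproof (f : sub_edge) : tgt (val f) \in W.
Proof. by case/and3P: (valP f). Qed.

Definition subgraph : mgraph :=
  @MGraph sub_vertex sub_edge
    (fun f => exist _ (src (val f)) (sub_src_subproof f))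
    (fun f => exist _ (tgt (val f)) (sub_tgt_subproof f)).
End Subgraph.

Definition remove_vertices (G : mgraph) (X : {set vertex G}) : mgraph :=
  subgraph (~: X) [set: edge G].

(* G/e: e is removed and tgt e is identified with src e, which represents the    *)
(* merged vertex.  Parallel edges and loops that arise are kept.  If e is a      *)
(* loop, merge_ends e is the identity, so that G/e is G with e deleted.          *)
Section Contract.
Variables (G : mgraph) (e : edge G).

Definition merge_ends (x : vertex G) : vertex G := if x == tgt e then src e else x.

Definition contract_vertex : finType := {x : vertex G | x \in codom merge_ends}.

Definition contract_edge : finType := {f : edge G | f != e}.

Definition contract_proj (x : vertex G) : contract_vertex :=
  exist _ (merge_ends x) (codom_f merge_ends x).

Definition contract : mgraph :=
  @MGraph contract_vertex contract_edge
    (fun f => contract_proj (src (val f)))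
    (fun f => contract_proj (tgt (val f))).
End Contract.

(* minor H G: G has an H-minor, i.e. a graph isomorphic to H arises from G by    *)
(* successively passing to subgraphs and contracting edges.                      *)
Inductive minor (H : mgraph) : mgraph -> Prop :=
| MinorIso (G : mgraph) : isomorphic H G -> minor H G
| MinorSub (G : mgraph) (W : {set vertex G}) (F : {set edge G}) :
    minor H (subgraph W F) -> minor H G
| MinorContract (G : mgraph) (e : edge G) : minor H (contract e) -> minor H G.

(* The null graph is connected.                                                  *)
Definition connected (G : mgraph) : Prop :=
  forall x y : vertex G, connect (@adjacent G) x y.

(* No lower bound on the order of G is required.                                 *)
Definition k_connected (k : nat) (G : mgraph) : Prop :=
  forall X : {set vertex G}, #|X| < k -> connected (remove_vertices X).

(* G has a cycle of length n, for n > 0: one of length 1 is a loop, one of       *)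
(* length 2 a pair of parallel edges.                                            *)
Definition has_cycle (G : mgraph) (n : nat) : Prop :=
  exists (v : 'I_n -> vertex G) (e : 'I_n -> edge G),
    [/\ injective v, injective e & forall i, joins (e i) (v i) (v (ordS i))].

Definition triangle_free (G : mgraph) : Prop := ~ has_cycle G 3.

Definition forest (G : mgraph) : Prop := forall n : nat, 0 < n -> ~ has_cycle G n.

Definition contractible (H G : mgraph) (e : edge G) : Prop :=
  k_connected 3 (contract e) /\ minor H (contract e).

(* Main.v *)
Require Import Defs.
From mathcomp Require Import all_boot.
From Stdlib Require Import Classical.

Set Implicit Arguments.
Unset Strict Implicit.
Unset Printing Implicit Defensive.

(* View an H-minor as a model: a map phi from V(G) onto V(H) with connected     *)
(* fibres that realises the edges of H.  The key claim is that the ends of an   *)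
(* edge xy inside a fibre of a model are joined by a path of H-contractible     *)
(* edges; equivalently, a labelling l of V(G) that is constant on the           *)
(* H-contractible edges is constant on fibres, and then has at most |H| values. *)
(* A forest with |G| - |H| edges is obtained greedily.                          *)
(*   If l x <> l y, then xy is not contractible in the 3-connected sense, so    *)
(* there is a 3-cut {x, y, z}.  As H is 3-connected, one side D of this cut     *)
(* has phi(D) within {phi x, phi z}; D can be moved to either of these fibres,  *)
(* so every edge meeting D preserves the H-minor.  Take such x, y, z, D with D  *)
(* minimal.  Some edge uv with u in D and v in D, x or y has l u <> l v, hence  *)
(* lies in a 3-cut {u, v, w}.  Uncrossing the two cuts yields a smaller D or a  *)
(* triangle.                                                                    *)

(** The heart is an exchange statement: a labelling constant on all H-contractible edges is constant
    on the fibres of every H-model ([label_constant_on_fibres], applied in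
    [contractible_edge_between]). Label the vertices by the components of the forest built so far.
    With fewer than |G| - |H| edges there are more than |H| labels, so some fibre carries two of
    them and a contractible edge joins two components; [contractible_forest] iterates this.

    For the exchange statement, suppose an edge xy inside a fibre changes the label. Contracting it
    keeps the H-minor, so it must destroy 3-connectedness, which puts x and y in a 3-cut {x, y, z}
    ([contract_not_three_connected]). Since H is 3-connected, one side of the cut meets only the
    fibres of x and z ([exists_preserving_side]), and handing that whole side to either fibre gives
    another model ([model_move]), so every edge meeting the side can be contracted without losing
    the minor. In a smallest such side, a label-changing edge uv has a 3-cut {u, v, w} of its own.
    The corners of the two crossing cuts are excluded by minimality or by 3-connectedness until a
    triangle remains ([no_preserving_side]).

    Cuts and models are treated for bare adjacency relations; multigraphs, contraction and minors
    are then translated into these terms. *)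

(** * Crossing 3-cuts *)

Section Cuts.
Variables (V : finType) (adj : rel V).
Hypothesis adj_sym : symmetric adj.

(** [D] is a union of components of the graph minus [X], not necessarily a single one, so that the
    vertices left over form a side again. *)
Definition cut_side (X D : {set V}) :=
  [/\ [disjoint D & X], D != set0, D :|: X != setT
    & forall u v, u \in D -> adj u v -> v \in D :|: X].

Definition three_conn := forall X D, cut_side X D -> 2 < #|X|.

Lemma cut_side_compl X D : cut_side X D -> cut_side X (~: (D :|: X)).
Proof.
case=> dis D0 DT cl; split.
- by rewrite disjoints_subset setCU subsetIr.
- by apply: contra DT => /eqP E; rewrite -[_ :|: _]setCK E setC0.
- apply/eqP => /setP E; case/set0Pn: D0 => d dD; move: (E d).
  by rewrite !inE dD (disjointFr dis dD).
- move=> u v; rewrite !inE !negb_or => /andP[uD uX] uv.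
  case vX: (v \in X); rewrite ?orbT ?orbF //= andbT; apply/negP => vD.
  have := cl v u vD; rewrite adj_sym => /(_ uv).
  by rewrite inE (negbTE uD) (negbTE uX).
Qed.

(** A vertex of [X] without a neighbour in [D] could be passed to the far side, leaving a cut with
    at most two vertices. *)
Lemma cut_side_nbr X D s : three_conn -> cut_side X D -> #|X| <= 3 ->
  s \in X -> exists2 d, d \in D & adj s d.
Proof.
move=> c3 [dis D0 DT cl] cX sX.
case: (boolP [exists d in D, adj s d]) => [/exists_inP[d dD sd]|/exists_inPn H].
  by exists d.
suff /c3: cut_side (X :\ s) D by move: cX; rewrite (cardsD1 s X) sX add1n ltnS leqNgt => /negP.
have sD : s \notin D by apply/negP => sD; rewrite (disjointFr dis sD) in sX.
split=> //.
- by apply: disjointWr dis; apply: subsetDl.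
- by apply/eqP => /setP/(_ s); rewrite !inE eqxx (negbTE sD).
- move=> u v uD uv; have := cl u v uD uv; rewrite !inE.
  case: eqP => // E; subst v; move: (H u uD); by rewrite adj_sym uv.
Qed.

(** In the application [l] is constant on contractible edges and [pres u v] says that some model has
    [u] and [v] in one fibre. An edge with [pres] and different labels then fails to be contractible
    only through a 3-cut, which is [cut_of_edge]. *)
Variables (L : eqType) (l : V -> L) (pres : V -> V -> Prop).
Hypothesis c3 : three_conn.
Hypothesis no_triangle : forall a b c,
  a != b -> b != c -> a != c -> adj a b -> adj b c -> adj a c -> False.
Hypothesis cut_of_edge : forall u v, adj u v -> pres u v -> l u != l v ->
  exists w F, cut_side [set u; v; w] F.

Lemma cut3_neq a b c D : cut_side [set a; b; c] D -> [/\ a != b, a != c & b != c].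
Proof.
move/c3; rewrite setUC cardsU1 cards2 !inE negb_or (eq_sym c a) (eq_sym c b).
by case: (a =P b); case: (a =P c); case: (b =P c).
Qed.

Lemma card_set3 (a b c : V) : #|[set a; b; c]| <= 3.
Proof. rewrite setUC cardsU1 cards2; by case: (_ \notin _); case: (_ != _). Qed.

Lemma set3P (t a b c : V) : t \in [set a; b; c] -> [\/ t = a, t = b | t = c].
Proof.
by rewrite !inE => /orP[/orP[]|] /eqP; [constructor 1|constructor 2|constructor 3].
Qed.

(** Otherwise the vertices of [D] labelled [l x] have no neighbours outside except [x] and [z]. They
    exist because [x] has a neighbour in [D], so [x] and [z] would separate them from [y]. *)
Lemma crossing_edge x y z D : l x != l y -> cut_side [set x; y; z] D ->
  exists u v, [/\ u \in D, adj u v, l u != l v & v \in D :|: [set x; y]].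
Proof.
move=> lxy cs; have [nxy nxz nyz] := cut3_neq cs.
case: (boolP [exists u in D, exists v in D :|: [set x; y], adj u v && (l u != l v)]).
  by case/exists_inP=> u uD /exists_inP[v vD /andP[uv luv]]; exists u, v.
move/exists_inPn=> H.
have {}H u v : u \in D -> v \in D :|: [set x; y] -> adj u v -> l u = l v.
  move=> uD vD uv; move/exists_inPn: (H u uD) => /(_ v vD).
  by rewrite uv /= negbK => /eqP.
have cx : x \in [set x; y; z] by rewrite !inE eqxx.
case: (cut_side_nbr c3 cs (card_set3 _ _ _) cx) => d dD xd.
have ldx : l d = l x by apply: H; rewrite ?(adj_sym d) // !inE eqxx orbT.
case: cs => dis D0 DT cl.
have yD : y \notin D.
  by apply/negP => /(disjointFr dis); rewrite !inE eqxx orbT.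
suff /c3: cut_side [set x; z] [set t in D | l t == l x] by rewrite cards2; case: (_ != _).
split.
- apply: disjointWl (disjointWr _ dis); first by apply/subsetP => t; rewrite inE => /andP[].
  by apply/subsetP => t; rewrite !inE => /orP[]->; rewrite ?orbT.
- by apply/set0Pn; exists d; rewrite inE dD ldx /=.
- apply/eqP => /setP/(_ y); rewrite !inE (negbTE yD) /= (eq_sym y x) (negbTE nxy).
  by rewrite (negbTE nyz).
- move=> u v; rewrite !inE => /andP[uD /eqP lu] uv.
  have := cl u v uD uv; rewrite !inE.
  case vD: (v \in D); first by rewrite -(H u v) ?inE ?vD // lu eqxx.
  case vy: (v == y); last by case: (v == x); case: (v == z).
  move/eqP: vy => vy; subst v; move: lxy.
  by rewrite -lu (H u y) ?inE ?eqxx ?orbT.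
Qed.

(** The hypothesis on [D] passes to subsets, so induction on [#|D|] excludes every corner inside [D]
    whose boundary is a 3-cut containing both ends of a label-changing edge. *)
Lemma no_preserving_side x y z D : adj x y -> l x != l y -> cut_side [set x; y; z] D ->
  (forall u v, u \in D -> adj u v -> pres u v) -> False.
Proof.
have [n] := ubnP #|D|; elim: n x y z D => // n IH x y z D leD xy lxy cs prD.
have [u [v [uD uv luv vDxy]]] := crossing_edge lxy cs.
(* The roles of [x] and [y] are symmetric, so [v] lies in [D] or equals [x]. *)
wlog vy : x y xy lxy cs vDxy / v != y.
  move=> W; case: (eqVneq v y) => [vy|]; last exact: (W x y).
  have [nxy _ _] := cut3_neq cs.
  apply: (W y x) => //; first by rewrite adj_sym.
  - by rewrite eq_sym.
  - by rewrite (setUC [set y]).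
  - by rewrite (setUC [set y]).
  - by rewrite vy eq_sym.
have [w [F0 csF0]] := cut_of_edge uv (prD u v uD uv) luv.
have [nxy nxz nyz] := cut3_neq cs.
have [nuv nuw nvw] := cut3_neq csF0.
set S := [set x; y; z] in cs; set T := [set u; v; w] in csF0.
have [dis D0 DT cl] := cs.
have uS : u \in S = false by rewrite (disjointFr dis uD).
have smaller a b c D' : adj a b -> l a != l b -> cut_side [set a; b; c] D' ->
    D' \subset D :\ u -> False.
  move=> ab lab csD' sub; apply: (IH a b c D') => //.
    apply: leq_ltn_trans (subset_leq_card sub) _.
    by move: leD; rewrite (cardsD1 u D) uD add1n.
  move=> p q /(subsetP sub); rewrite inE => /andP[_ pD]; exact: prD.
(* A part of the second cut inside [D] would contradict minimality, so each    *)
(* side of that cut meets [S].                                                 *)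
have meet F : cut_side T F -> exists2 s, s \in F & s \in S.
  move=> csF; have [disF F0' FT clF] := csF.
  have uF : u \notin F.
    by apply/negP => /(disjointFr disF); rewrite !inE eqxx.
  apply/exists_inP; apply: contraT => /exists_inPn H.
  case: (set_0Vmem (F :&: D)) => [E|[d dFD]].
    have uT : u \in T by rewrite !inE eqxx.
    have [d dF ud] := cut_side_nbr c3 csF (card_set3 _ _ _) uT.
    have := cl u d uD ud; rewrite inE (negbTE (H d dF)) orbF => dD.
    by move/setP/(_ d): E; rewrite inE dF dD inE.
  exfalso; apply: (smaller u v w (F :&: D)) => //; last first.
    by apply/subsetP => t; rewrite !inE => /andP[tF ->]; rewrite andbT; apply: contraNneq uF => <-.
  split.
  - by apply: disjointWl disF; apply: subsetIl.
  - by apply/set0Pn; exists d.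
  - by apply: contra FT; rewrite -!subTset => /subset_trans; apply; apply: setSU; apply: subsetIl.
  - move=> p q; rewrite inE => /andP[pF pD] pq.
    have /setUP[qF|qT] := clF p q pF pq; rewrite in_setU ?qT ?orbT // in_setI qF.
    by have := cl p q pD pq; rewrite in_setU (negbTE (H q qF)) orbF => ->.
have complF : forall F, cut_side T F -> cut_side T (~: (F :|: T)).
  by move=> F; apply: cut_side_compl.
have vDS : v \in D :|: S.
  by move: vDxy; rewrite !inE => /or3P[]->; rewrite ?orbT.
(* Otherwise the part of each side in the complement [C] of [D :|: S] has at    *)
(* most two neighbours outside it, so it is empty, and [C] would be empty.      *)
have wC : w \notin D :|: S.
  apply/negP => wDS.
  have [c cC] : exists c, c \notin D :|: S.
    by move: DT; rewrite -subTset => /subsetPn[c _ ?]; exists c.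
  have cT : c \notin T.
    rewrite !inE !negb_or; apply/andP; split; first (apply/andP; split).
    + by apply: contraNneq cC => ->; rewrite inE uD.
    + by apply: contraNneq cC => ->.
    + by apply: contraNneq cC => ->.
  have TDS : T \subset D :|: S.
    by apply/subsetP => t; rewrite !inE => /orP[/orP[]|] /eqP->; rewrite ?uD //;
      move: vDS wDS; rewrite !inE.
  have K F : cut_side T F -> c \in F -> False.
    move=> csF cF; have [disF F0' FT clF] := csF.
    have [s sF2 sS] := meet _ (complF _ csF).
    have uF : u \notin F.
      by apply/negP => /(disjointFr disF); rewrite !inE eqxx.
    (* The opposite side of [T] takes the vertex [s] of [S], so only the other two vertices of [S]
       can bound this corner. *)
    suff /c3: cut_side (S :\ s) (F :\: (D :|: S)).
      have := card_set3 x y z; rewrite -/S (cardsD1 s S) sS add1n ltnS => le2.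
      by rewrite ltnNge le2.
    split.
    - rewrite disjoints_subset; apply/subsetP => t /setDP[_].
      by rewrite in_setC in_setU in_setD1 negb_or => /andP[_ /negbTE->]; rewrite andbF.
    - by apply/set0Pn; exists c; rewrite inE cC.
    - by apply/eqP => /setP/(_ u); rewrite in_setU in_setD1 uS andbF orbF in_setD (negbTE uF) andbF in_setT.
    - move=> p q /setDP[pF pDS] pq; have qFT := clF p q pF pq.
      have qD : q \notin D.
        by apply: contra pDS => qD; apply: cl qD _; rewrite adj_sym.
      rewrite in_setU in_setD1 in_setD in_setU (negbTE qD) /=.
      case qS: (q \in S); first by
        rewrite /= andbT; apply: contraTneq sF2 => <-; rewrite in_setC qFT.
      rewrite andbF /=; case/setUP: qFT => [->//|/(subsetP TDS)].
      by rewrite in_setU (negbTE qD) qS.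
  have [cF|cF] := boolP (c \in F0); first exact: (K F0 csF0 cF).
  by apply: (K _ (complF _ csF0)); rewrite !inE negb_or cF /=; move: cT; rewrite !inE.
have outT F t : cut_side T F -> t \in T -> t \notin F.
  by case=> disF _ _ _ tT; apply/negP => /(disjointFr disF); rewrite tT.
have uT : u \in T by rewrite !inE eqxx.
have vT : v \in T by rewrite !inE eqxx orbT.
have uF F : cut_side T F -> u \notin F by move/outT; apply.
have vF F : cut_side T F -> v \notin F by move/outT; apply.
have wS : w \in S = false by apply: contraNF wC => wS; rewrite in_setU wS orbT.
have wD : w \in D = false by apply: contraNF wC => wD; rewrite in_setU wD.
have [xS yS zS] : [/\ x \in S, y \in S & z \in S] by rewrite !inE !eqxx ?orbT.
(* Outside neighbours of the corner [F :&: D] lie either in [T] within [D :|: S] or in [S] within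
   [F]. The vertex [w] shows that [X] and the corner do not exhaust the graph. *)
have inD F (X : {set V}) : cut_side T F -> X \subset D :|: S ->
    [disjoint F :&: D & X] -> T :&: (D :|: S) \subset X -> S :&: F \subset X ->
    F :&: D != set0 -> cut_side X (F :&: D).
  move=> [_ _ _ clF] XDS disX TX SX FD0; split=> //.
    apply/eqP => /setP/(_ w); rewrite in_setU in_setI wD andbF in_setT /=.
    by move/(subsetP XDS); apply/negP.
  move=> p q /setIP[pF pD] pq; have := clF p q pF pq; have := cl p q pD pq.
  rewrite !(in_setU _ (_ :&: _)) in_setI => qDS.
  case/setUP => [qF|qT]; last by rewrite (subsetP TX) ?orbT // in_setI qT.
  case/setUP: qDS => [->|qS]; first by rewrite qF.
  by rewrite (subsetP SX) ?orbT // in_setI qS.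
have nsep F : cut_side T F -> x \in F -> y \in ~: (F :|: T) -> False.
  by case=> _ _ _ clF xF; rewrite inE (clF x y xF xy).
(* If [v \in D], the side of [z] reduces to [z], and [u], [v], [z] form a       *)
(* triangle; if [v = x], then [D] reduces to [u], and [x], [y], [u] form one.    *)
have [vD|vD] := boolP (v \in D).
  have K F : cut_side T F -> z \in F -> x \notin F -> y \notin F -> False.
    move=> csF zF xF yF.
    have SF t : t \in S -> t \in F -> t = z.
      rewrite !inE => /orP[/orP[]|] /eqP-> //; by rewrite ?(negbTE xF) ?(negbTE yF).
    have FD : F :&: D = set0.
      (* This corner is bounded by [u], [v], [z], and the edge [uv] changes the label. *)
      apply: contraTeq isT => FD; exfalso.
      apply: (@smaller u v z (F :&: D) uv luv); last first.
        apply/subsetP => t /setIP[tF tD]; rewrite !inE tD andbT.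
        by apply: contraTneq tF => ->; apply: uF.
      apply: inD => //.
      + by apply/subsetP => t; rewrite !inE => /orP[/orP[]|] /eqP ->; rewrite ?uD ?vD ?eqxx ?orbT.
      + rewrite disjoint_sym disjoints_subset; apply/subsetP => t.
        rewrite !inE => /orP[/orP[]|] /eqP ->; rewrite ?(negbTE (uF F csF)) ?(negbTE (vF F csF)) //.
        by rewrite (disjointFl dis) ?andbF.
      + apply/subsetP => t /setIP[/setUP[tuv _|/set1P-> /idPn[]//]].
        by rewrite in_setU tuv.
      + apply/subsetP => t /setIP[tS tF]; by rewrite (SF t tS tF) !inE eqxx orbT.
    (* This corner is bounded by [z] and [w] alone, too few for a cut. *)
    have FC : F :\: (D :|: S) = set0.
      apply: contraTeq isT => FC; exfalso.
      suff /c3: cut_side [set z; w] (F :\: (D :|: S)) by rewrite cards2; case: (_ != _).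
      split=> //.
      + rewrite disjoint_sym disjoints_subset; apply/subsetP => t; rewrite !inE.
        by case/orP=> /eqP->; rewrite ?eqxx ?orbT // (negbTE (outT F w csF _)) ?andbF // !inE eqxx ?orbT.
      + apply/eqP => /setP/(_ u); rewrite !inE uD /= (negbTE nuw) orbF => /eqP uz.
        by move: zS; rewrite -uz uS.
      + case: csF => _ _ _ clF p q /setDP[pF pDS] pq.
        have := clF p q pF pq; have [qD|qD] := boolP (q \in D).
          by have := cl q p qD; rewrite adj_sym (negbTE pDS) => /(_ pq).
        have [qS|qS] := boolP (q \in S).
          case/setUP=> [qF|]; first by rewrite (SF q qS qF) in_setU set21 orbT.
          case/set3P=> E; subst q.
          * by rewrite uS in qS.
          * by rewrite vD in qD.
          * by rewrite wS in qS.
        case/setUP=> [qF|].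
          by rewrite in_setU in_setD in_setU (negbTE qD) (negbTE qS) qF.
        case/set3P=> E; subst q.
        * by rewrite uD in qD.
        * by rewrite vD in qD.
        * by rewrite in_setU set22 orbT.
    have Fz t : t \in F -> t = z.
      move=> tF; apply: SF => //; move/setP/(_ t): FD; rewrite !inE tF /= => tD.
      by move/setP/(_ t): FC; rewrite !inE tF tD andbT /= => /negbFE.
    have [d /Fz-> uz] := cut_side_nbr c3 csF (card_set3 _ _ _) uT.
    have [e /Fz-> vz] := cut_side_nbr c3 csF (card_set3 _ _ _) vT.
    apply: (@no_triangle u v z) => //.
      by apply: contraTneq vD => ->; rewrite (disjointFl dis).
    by apply: contraTneq uD => ->; rewrite (disjointFl dis).
  have ST t : t \in S -> t \notin T.
    move=> tS; apply/negP; case/set3P=> E; subst t.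
    - by rewrite uS in tS.
    - by rewrite (disjointFr dis vD) in tS.
    - by rewrite wS in tS.
  (* The adjacent vertices [x] and [y] avoid [T], so they lie on the same side; were it the side of
     [z], the opposite side would miss [S]. *)
  have K' F : cut_side T F -> z \in F -> False.
    move=> csF zF; have csF2 := complF _ csF.
    have [s sF2 sS] := meet _ csF2.
    have xyF : (x \in F) = (y \in F).
      apply/idP/idP => [xF|yF]; apply: contraT => nF; exfalso.
        by apply: (nsep F) => //; rewrite !inE negb_or nF /=; have:= ST y yS; rewrite !inE.
      apply: (nsep _ csF2).
        by rewrite inE inE negb_or nF /= ST.
      by rewrite inE inE negb_or inE inE yF (negbTE (ST y yS)).
    have nxF : x \notin F.
      apply/negP => xF; move: sF2; rewrite inE inE negb_or => /andP[].
      by move: sS; case/set3P=> ->; rewrite -?xyF ?xF ?zF.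
    by apply: (K F) => //; rewrite -xyF.
  have [zF|zF] := boolP (z \in F0); first exact: (K' F0).
  by apply: (K' _ (complF _ csF0)); rewrite inE inE negb_or zF ST.
have {vD vy} vx : v = x.
  by move: vDxy; rewrite !inE (negbTE vD) (negbTE vy) orbF /= => /eqP.
have yT : y \notin T.
  apply/negP => /set3P[]E; subst y.
  - by rewrite uS in yS.
  - by rewrite vx eqxx in nxy.
  - by rewrite wS in yS.
have K F : cut_side T F -> y \in F -> z \notin F -> False.
  move=> csF yF zF; have csF2 := complF _ csF.
  have [s sF2 sS] := meet _ csF2.
  (* The opposite side meets [S], while [x] is in [T] and [y] is in [F]. *)
  have zF2 : z \in ~: (F :|: T).
    move: sF2; have sT := outT _ s csF2; move: sS; case/set3P=> -> //.
      by rewrite -vx => /(negP (vF _ csF2)).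
    by rewrite inE inE yF.
  have yF2 : y \notin ~: (F :|: T) by rewrite inE inE yF.
  have xF E : cut_side T E -> x \notin E by rewrite -vx; apply: vF.
  (* Here the boundary is [x], [y], [u] with the label-changing edge [xy]; for the opposite corner
     below it is [v], [u], [z] with the edge [vu]. *)
  have FD : F :&: D = set0.
    apply: contraTeq isT => FD; exfalso.
    apply: (@smaller x y u (F :&: D) xy lxy); last first.
      apply/subsetP => t /setIP[tF tD]; rewrite !inE tD andbT.
      by apply: contraTneq tF => ->; apply: uF.
    apply: inD => //.
    + by apply/subsetP => t; rewrite !inE => /orP[/orP[]|] /eqP ->; rewrite ?uD ?eqxx ?orbT.
    + rewrite disjoint_sym disjoints_subset; apply/subsetP => t.
      case/set3P=> ->; rewrite inE inE.
      * by rewrite (negbTE (xF F csF)).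
      * by rewrite (disjointFl dis) ?andbF.
      * by rewrite (negbTE (uF F csF)).
    + apply/subsetP => t /setIP[]; case/set3P=> ->.
      * by rewrite !inE eqxx ?orbT.
      * by rewrite vx !inE eqxx ?orbT.
      * by rewrite (negbTE wC).
    + apply/subsetP => t /setIP[tS tF]; move: tS tF; case/set3P=> ->.
      * by rewrite !inE eqxx ?orbT.
      * by rewrite !inE eqxx ?orbT.
      * by rewrite (negbTE zF).
  have F2D : ~: (F :|: T) :&: D = set0.
    apply: contraTeq isT => F2D; exfalso; rewrite -vx in nxz.
    have vu : adj v u by rewrite adj_sym.
    have lvu : l v != l u by rewrite eq_sym.
    apply: (@smaller v u z (~: (F :|: T) :&: D) vu lvu); last first.
      apply/subsetP => t /setIP[tF tD]; rewrite in_setD1 tD andbT.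
      by apply: contraTneq tF => ->; apply: uF.
    apply: inD F2D => //.
    + by apply/subsetP => t; rewrite vx !inE => /orP[/orP[]|] /eqP ->; rewrite ?uD ?eqxx ?orbT.
    + rewrite disjoint_sym disjoints_subset; apply/subsetP => t.
      case/set3P=> ->; rewrite inE inE.
      * by rewrite (negbTE (vF _ csF2)).
      * by rewrite (negbTE (uF _ csF2)).
      * by rewrite (disjointFl dis) ?andbF.
    + apply/subsetP => t /setIP[]; case/set3P=> ->.
      * by rewrite !inE eqxx ?orbT.
      * by rewrite !inE eqxx ?orbT.
      * by rewrite (negbTE wC).
    + apply/subsetP => t /setIP[tS tF]; move: tS tF; case/set3P=> ->.
      * by rewrite vx !inE eqxx ?orbT.
      * by rewrite (negbTE yF2).
      * by rewrite !inE eqxx ?orbT.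
  (* Both corners are empty, so [D] lies in [T] and consists of [u] alone. *)
  have [d dD yd] := cut_side_nbr c3 cs (card_set3 _ _ _) yS.
  have du : d = u.
    move/setP/(_ d): FD; rewrite inE dD andbT in_set0 => dF.
    move/setP/(_ d): F2D; rewrite inE dD andbT inE inE dF in_set0 => /negbFE.
    case/set3P=> [//|E|E]; subst d.
      by move: dD; rewrite vx (disjointFl dis).
    by rewrite wD in dD.
  subst d; apply: (@no_triangle x y u) => //.
  - by apply: contraTneq yS => ->; rewrite uS.
  - by apply: contraTneq xS => ->; rewrite uS.
  - by rewrite adj_sym -vx.
have yz F : cut_side T F -> y \in F -> z \notin F.
  move=> csF yF; apply/negP => zF; have [s sF2] := meet _ (complF _ csF).
  case/set3P=> E; subst s; move: sF2.
  - by rewrite -vx inE inE vT orbT.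
  - by rewrite inE inE yF.
  - by rewrite inE inE zF.
have [yF|yF] := boolP (y \in F0); first by apply: (K F0); rewrite ?yz.
have yF2 : y \in ~: (F0 :|: T) by rewrite inE inE negb_or yF.
have csF2 := complF _ csF0.
by apply: (K _ csF2 yF2); rewrite yz.
Qed.
End Cuts.

(** * Models of minors *)

Section Models.
Variables (V W : finType) (adj : rel V) (adjH : rel W).
Hypothesis adj_sym : symmetric adj.

(* [psi u = None] means that the model does not use [u].  The second clause     *)
(* says that the fibre of [a] is connected, in terms of closed sets instead of  *)
(* paths.                                                                       *)
Definition partial_model (psi : V -> option W) :=
  [/\ forall a, exists u, psi u = Some a,
      forall (B : {set V}) a u v, u \in B -> psi u = Some a -> psi v = Some a ->
        (forall s t, s \in B -> adj s t -> psi s = Some a -> psi t = Some a ->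
          t \in B) -> v \in B
    & forall a b, a != b -> adjH a b ->
        exists u v, [/\ psi u = Some a, psi v = Some b & adj u v]].

Definition model (phi : V -> W) :=
  [/\ forall a, exists u, phi u = a,
      forall (B : {set V}) u v, u \in B -> phi v = phi u ->
        (forall s t, s \in B -> adj s t -> phi s = phi u -> phi t = phi u ->
          t \in B) -> v \in B
    & forall a b, a != b -> adjH a b ->
        exists u v, [/\ phi u = a, phi v = b & adj u v]].

Hypothesis c3 : three_conn adj.

Lemma partial_model_extend psi : 0 < #|W| -> partial_model psi -> exists phi, model phi.
Proof.
move=> W0; have [n] := ubnP #|[set u | psi u == None]|.
elim: n psi => // n IH psi leN [surj conn edges].
have [a0 _] : exists a, a \in W by apply/card_gt0P.
case: (set_0Vmem [set u | psi u == None]) => [E|[v0 v0N]].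
  have tot u : psi u = Some (odflt a0 (psi u)).
    by move/setP/(_ u): E; rewrite !inE; case: (psi u).
  exists (fun u => odflt a0 (psi u)); split.
  - by move=> a; have [u ua] := surj a; exists u; rewrite ua.
  - move=> B u v uB vu clB; apply: (conn B (odflt a0 (psi u)) u) => //.
      by rewrite (tot v) vu.
    move=> s t sB st sa ta; apply: (clB s t) => //; by rewrite ?sa ?ta.
  - by move=> a b ab /(edges a b ab)[u [v [ua vb uv]]]; exists u, v; rewrite ua vb.
have [u [v [uN vN uv]]] : exists u v, [/\ psi u != None, psi v = None & adj u v].
  case: (boolP [exists u, exists v, [&& psi u != None, psi v == None & adj u v]]).
    by case/existsP=> u /existsP[v /and3P[? /eqP ? ?]]; exists u, v.
  move/existsPn=> H.
  suff /c3: cut_side adj set0 [set u | psi u == None] by rewrite cards0.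
  split.
  - by rewrite -setI_eq0 setI0.
  - by apply/set0Pn; exists v0.
  - rewrite setU0; have [u ua] := surj a0.
    by apply/eqP => /setP/(_ u); rewrite !inE ua.
  - move=> s t; rewrite !inE orbF => sN st; apply: contraT => tN.
    by move/existsPn: (H t) => /(_ s); rewrite sN tN adj_sym st.
case Ea: (psi u) uN => [a|//] _.
pose psi' t := if t == v then Some a else psi t.
have psi'E t : psi t != None -> psi' t = psi t.
  by rewrite /psi'; case: (t =P v) => // ->; rewrite vN.
apply: (IH psi').
  rewrite -ltnS; apply: leq_trans leN; rewrite ltnS; apply: proper_card.
  apply/properP; split; last by exists v; rewrite inE ?vN // /psi' eqxx.
  by apply/subsetP => t; rewrite !inE /psi'; case: (t == v).
have u' : psi' u = Some a by rewrite psi'E Ea.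
split.
- by move=> b; have [t tb] := surj b; exists t; rewrite psi'E tb.
- move=> B b s t sB sb tb clB.
  have old s' : s' \in B -> psi s' = Some b -> forall t', psi t' = Some b -> t' \in B.
    move=> s'B s'b t' t'b; apply: (conn B b s' t') => // p q pB pq pb qb.
    by apply: (clB p q); rewrite // psi'E ?pb ?qb.
  have {}old t' : psi t' = Some b -> t' \in B.
    move: sb; rewrite /psi'; case: (s =P v) => [E [ab]|_ sb]; last exact: (old s).
    apply: (old u); last by rewrite Ea ab.
    by apply: (clB s u) => //; rewrite ?E 1?adj_sym -?ab // /psi' eqxx.
  move: tb; rewrite /psi'; case: (t =P v) => [E [ab]|_ tb]; last exact: old.
  by subst t b; apply: (clB u v); rewrite ?old // /psi' eqxx.
- move=> b c bc /(edges b c bc)[p [q [pb qc pq]]]; exists p, q.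
  by rewrite !psi'E ?pb ?qc.
Qed.

Section Move.
Variables (phi : V -> W) (x y z : V) (D : {set V}).
Hypotheses (phi_model : model phi) (xy : adj x y) (phi_xy : phi x = phi y).
Hypothesis csD : cut_side adj [set x; y; z] D.
Hypothesis phiD : forall u, u \in D -> phi u = phi x \/ phi u = phi z.
Hypothesis phi_xz : phi x != phi z.

Let S := [set x; y; z].
Let nbr_out u v : u \in D -> adj u v -> v \notin D -> v \in S.
Proof.
by case: csD => _ _ _ cl uD /(cl _ _ uD)/setUP[->|//].
Qed.

Let notD s : s \in S -> s \notin D.
Proof. by case: csD => dis _ _ _ sS; rewrite (disjointFl dis). Qed.

Let S_nbr s : s \in S -> exists2 d, d \in D & adj s d.
Proof. exact: (cut_side_nbr adj_sym c3 csD (card_set3 _ _ _)). Qed.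

Let xS : x \in S. Proof. by rewrite !inE eqxx. Qed.
Let yS : y \in S. Proof. by rewrite !inE eqxx orbT. Qed.
Let zS : z \in S. Proof. by rewrite !inE eqxx orbT. Qed.

Let S_fibre s t : s \in S -> t \in S -> phi s = phi t -> s = t \/ adj s t.
Proof.
by case/set3P=> ->; case/set3P=> -> E; rewrite 1?(adj_sym y); auto;
   move: phi_xz; rewrite ?phi_xy -?E ?phi_xy ?eqxx // -?phi_xy E eqxx.
Qed.

(** Deleting [D] keeps a fibre connected: an excursion into [D] leaves and returns through vertices
    of [S] in the same fibre. Only [x] and [y] share a fibre, and they are adjacent. *)
Let fibre_minus (B : {set V}) u v : u \in B -> u \notin D -> phi v = phi u -> v \notin D ->
  (forall s t, s \in B -> adj s t -> s \notin D -> t \notin D -> phi s = phi u ->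
     phi t = phi u -> t \in B) -> v \in B.
Proof.
move=> uB uD vu vD clB; have [_ conn _] := phi_model.
case: (boolP [exists s in S, (s \in B) && (phi s == phi u)]) => [/exists_inP[s sS]|/exists_inPn H].
  case/andP=> sB /eqP su.
  suff: v \in B :|: D by rewrite inE (negbTE vD) orbF.
  apply: (conn _ u v) => //; first by rewrite inE uB.
  move=> p q; rewrite !inE => pBD pq pu qu.
  case qD: (q \in D); rewrite ?orbT ?orbF //.
  case pD: (p \in D) pBD; last by rewrite orbF => pB; apply: (clB p q); rewrite ?pD ?qD.
  move=> _; have qS : q \in S by apply: (nbr_out pD pq); rewrite qD.
  have sq : phi s = phi q by rewrite su qu.
  have [<-//|sq'] := S_fibre sS qS sq.
  by apply: (clB s q); rewrite ?notD.
suff: v \in B :\: D by rewrite inE => /andP[].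
apply: (conn _ u v) => //; first by rewrite inE uB uD.
move=> p q /setDP[pB pD] pq pu qu; rewrite inE.
case qD: (q \in D) => /=; last by apply: (clB p q); rewrite ?qD.
have pS : p \in S by apply: (nbr_out qD) => //; rewrite adj_sym.
by move: (H p pS); rewrite pB pu eqxx.
Qed.

(** Fibres stay connected outside [D] by [fibre_minus], and every part of [D] is linked to [s0],
    since two vertices cannot cut it off. Edges of H realised at [D] run between the fibres of [x]
    and [z] and are realised anew by edges between [S] and [D]. *)
Lemma model_move c s0 : s0 \in S -> phi s0 = c ->
  model (fun t => if t \in D then c else phi t).
Proof.
move=> s0S s0c; have [surj conn edges] := phi_model.
have s0D := notD s0S.
have [dis D0 DT cl] := csD.
split.
- move=> a; have [u ua] := surj a.
  case: (boolP (u \in D)) => [uD|uD]; last by exists u; rewrite (negbTE uD).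
  have [E|E] := phiD uD.
    by exists x; rewrite (negbTE (notD xS)) -E.
  by exists z; rewrite (negbTE (notD zS)) -E.
- move=> B u v uB; set a := if u \in D then c else phi u => va clB.
  have out s t : s \in B -> s \notin D -> phi s = a -> t \notin D -> phi t = a -> t \in B.
    move=> sB sD sa tD ta; apply: (fibre_minus sB sD _ tD); first by rewrite ta.
    move=> p q pB pq pD qD; rewrite sa => pa qa.
    by apply: (clB p q); rewrite ?(negbTE pD) ?(negbTE qD).
  have [ac|ac] := eqVneq a c; last first.
    have uD : u \notin D by apply: contraNN ac => uD; rewrite /a uD.
    have vD : v \notin D by apply: contraNN ac => vD; rewrite -va vD.
    apply: (out u v) => //; first by rewrite /a (negbTE uD).
    by rewrite -va (negbTE vD).
  have s0B : s0 \in B.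
    case: (boolP (u \in D)) => uD; last first.
      by apply: (out u) => //; rewrite ?ac // -ac /a (negbTE uD).
    apply: contraT => s0B.
    (* The part of [D] in [B] is closed within [D] and does not reach [s0], so only two vertices of
       [S] would bound it. *)
    suff /c3: cut_side adj (S :\ s0) (B :&: D).
      by have := card_set3 x y z; rewrite -/S (cardsD1 s0 S) s0S add1n ltnS leqNgt => /negbTE->.
    split.
    + by apply: disjointWl (disjointWr _ dis); [apply: subsetIr | apply: subsetDl].
    + by apply/set0Pn; exists u; rewrite inE uB.
    + apply/eqP => /setP/(_ s0).
      by rewrite in_setU in_setI (negbTE s0B) in_setD1 eqxx in_setT.
    + move=> p q /setIP[pB pD] pq; case/setUP: (cl p q pD pq) => [qD|qS]; rewrite in_setU.
        by rewrite in_setI qD (clB p q) // ?pD ?qD -?ac.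
      have [E|qs0] := eqVneq q s0; last by rewrite in_setD1 qs0 qS orbT.
      by subst q; move: s0B; rewrite (clB p s0) // ?pD ?(negbTE s0D) ?s0c ac.
  case: (boolP (v \in D)) => vD; last first.
    by apply: (out s0) => //; rewrite ?s0c ?ac // -ac -va (negbTE vD).
  apply: contraT => vB.
  suff /c3: cut_side adj (S :\ s0) (D :\: B).
    by have := card_set3 x y z; rewrite -/S (cardsD1 s0 S) s0S add1n ltnS leqNgt => /negbTE->.
  split.
  + by apply: disjointWl (disjointWr _ dis); apply: subsetDl.
  + by apply/set0Pn; exists v; rewrite inE vB.
  + apply/eqP => /setP/(_ s0).
    by rewrite in_setU in_setD s0B in_setD1 eqxx in_setT.
  + move=> p q /setDP[pD pB] pq; case/setUP: (cl p q pD pq) => [qD|qS]; rewrite in_setU.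
      rewrite in_setD qD andbT; case qB: (q \in B) => //.
      by move: pB; rewrite (clB q p) // ?pD ?qD 1?adj_sym.
    have [E|qs0] := eqVneq q s0; last by rewrite in_setD1 qs0 qS orbT.
    by subst q; move: pB; rewrite (clB s0 p) // ?pD ?(negbTE s0D) 1?adj_sym ?s0c ?ac.
- have xz_edge p q : p \in [set x; z] -> q \in [set x; z] -> p != q -> exists u v,
      [/\ (if u \in D then c else phi u) = phi p,
          (if v \in D then c else phi v) = phi q & adj u v].
    have two : c = phi x \/ c = phi z by case/set3P: s0S s0c => -> <-; auto.
    have pS r : r \in [set x; z] -> r \in S.
      by rewrite !inE => /orP[]->; rewrite ?orbT.
    have K r s : r \in [set x; z] -> s \in [set x; z] -> r != s -> c != phi r -> c = phi s.
      by rewrite !inE => /orP[]/eqP-> /orP[]/eqP->; rewrite ?eqxx //; case: two => ->; rewrite ?eqxx.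
    move=> p2 q2 pq; case: (eqVneq c (phi p)) => [cp|cp].
      have [d dD qd] := S_nbr (pS q q2).
      by exists d, q; rewrite dD (negbTE (notD (pS q q2))) adj_sym.
    have [d dD pd] := S_nbr (pS p p2).
    exists p, d; rewrite dD (negbTE (notD (pS p p2))); split=> //.
    exact: (K p q).
  move=> a b ab /(edges a b ab)[u [v [ua vb uv]]].
  have red p q : p \in D -> adj p q -> phi q \in [set phi x; phi z].
    move=> pD pq; have := cl p q pD pq; case/setUP=> [/phiD[]->|].
    + by rewrite set21.
    + by rewrite set22.
    by case/set3P=> ->; rewrite !inE -?phi_xy eqxx ?orbT.
  have red' p : p \in D -> phi p \in [set phi x; phi z].
    by case/phiD=> ->; rewrite !inE eqxx ?orbT.
  have fin : a \in [set phi x; phi z] -> b \in [set phi x; phi z] -> exists u v,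
      [/\ (if u \in D then c else phi u) = a,
          (if v \in D then c else phi v) = b & adj u v].
    move=> /set2P[] E1 /set2P[] E2; rewrite E1 E2 in ab *; rewrite ?eqxx // in ab;
      by apply: xz_edge; rewrite ?set21 ?set22 //; apply: contraNneq ab => ->.
  case: (boolP (u \in D)) => uD.
    by apply: fin; [rewrite -ua red' | rewrite -vb (red u)].
  case: (boolP (v \in D)) => vD.
    by apply: fin; [rewrite -ua (red v) // adj_sym | rewrite -vb red'].
  by exists u, v; rewrite (negbTE uD) (negbTE vD).
Qed.
End Move.

(** For the ends of an edge of G and simple H, this ensures that contracting the edge keeps the
    H-minor. *)
Definition preserving (u v : V) := exists2 phi, model phi & phi u = phi v.

Lemma side_preserving phi x y z D : model phi -> adj x y -> phi x = phi y ->
  cut_side adj [set x; y; z] D ->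
  (forall u, u \in D -> phi u = phi x \/ phi u = phi z) ->
  forall u v, u \in D -> adj u v -> preserving u v.
Proof.
move=> m xy exy cs phiD u v uD uv; have [dis D0 DT cl] := cs.
have sD s : s \in [set x; y; z] -> s \in D = false by exact: disjointFl dis.
have vDS := cl u v uD uv.
have [xz|xz] := eqVneq (phi x) (phi z).
  have K t : t \in D :|: [set x; y; z] -> phi t = phi x.
    by case/setUP=> [/phiD[]->|/set3P[]->].
  by exists phi; rewrite // !K // in_setU uD.
have move_to s : s \in [set x; y; z] -> model (fun t => if t \in D then phi s else phi t).
  by move=> sS; apply: (model_move m xy exy cs phiD xz sS).
case/setUP: vDS => [vD|vS].
  exists (fun t => if t \in D then phi x else phi t); last by rewrite uD vD.
  by apply: move_to; rewrite !inE eqxx.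
by exists (fun t => if t \in D then phi v else phi t); [apply: move_to | rewrite uD sD].
Qed.

Hypothesis c3H : three_conn adjH.
Hypothesis adjH_sym : symmetric adjH.

(** Fibres other than those of [x] and [z] avoid the cut, so each lies on one side. If both sides
    contained such fibres, the at most two vertices [phi x], [phi z] would separate H. *)
Lemma exists_preserving_side phi x y z A : model phi -> adj x y -> phi x = phi y ->
  cut_side adj [set x; y; z] A ->
  exists2 D, cut_side adj [set x; y; z] D &
    forall u v, u \in D -> adj u v -> preserving u v.
Proof.
move=> m xy exy cs; have [surj conn edges] := m.
set S := [set x; y; z] in cs *; have [dis A0 AT cl] := cs.
set P := [set phi x; phi z].
have fibS u : phi u \notin P -> u \notin S.
  by apply: contra => /set3P[]->; rewrite !inE -?exy eqxx ?orbT.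
have fib u v : phi u \notin P -> u \in A -> phi v = phi u -> v \in A.
  move=> uP uA vu; apply: (conn A u v) => // s t sA st _ tu.
  have := cl s t sA st; case/setUP=> // tS.
  by move: (fibS t); rewrite tu tS => /(_ uP).
pose B := [set a | (a \notin P) && [exists u in A, phi u == a]].
have BP a : a \in B -> (a \notin P) /\ (forall v, phi v = a -> v \in A).
  rewrite inE => /andP[aP /exists_inP[u uA /eqP ua]]; split=> // v va.
  by apply: (fib u); rewrite ?ua.
case: (set_0Vmem B) => [B0|[b bB]].
  exists A => //; apply: side_preserving m xy exy cs _ => u uA.
  move/setP/(_ (phi u)): B0; rewrite in_set0 inE => /negbT; rewrite negb_and negbK.
  case/orP=> [/set2P//|/exists_inPn/(_ u uA)]; by rewrite eqxx.
have cs' := cut_side_compl adj_sym cs.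
exists (~: (A :|: S)) => //; apply: side_preserving m xy exy cs' _ => u.
rewrite in_setC in_setU negb_or => /andP[uA uS].
apply/set2P; rewrite -/P; apply: contraT => uP.
suff /c3H: cut_side adjH P B by rewrite cards2; case: (_ != _).
split.
- by rewrite disjoints_subset; apply/subsetP => a /BP[aP _]; rewrite in_setC.
- by apply/set0Pn; exists b.
- apply/eqP => /setP/(_ (phi u)); rewrite in_setT in_setU (negbTE uP) orbF.
  by move=> /BP[_ /(_ u erefl)]; apply/negP.
- move=> a c aB ac; rewrite in_setU; case cP: (c \in P); rewrite ?orbT ?orbF //.
  have [E|nac] := eqVneq a c; first by rewrite -E.
  have [p [q [pa qc pq]]] := edges a c nac ac.
  have [aP /(_ p pa) pA] := BP a aB.
  rewrite inE cP /=; apply/exists_inP; exists q; last by rewrite qc.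
  have := cl p q pA pq; case/setUP=> // qS.
  by move: (fibS q); rewrite qc cP qS => /(_ isT).
Qed.
End Models.

(** Fibres are connected, so it suffices that no edge inside a fibre changes the label. Such an edge
    is preserving by [phi] itself, hence lies in a 3-cut with a preserving side, which
    [no_preserving_side] forbids. *)
Lemma label_constant_on_fibres (V W : finType) (adj : rel V) (adjH : rel W)
    (L : eqType) (l : V -> L) (phi : V -> W) :
  symmetric adj -> symmetric adjH -> three_conn adj -> three_conn adjH ->
  (forall a b c, a != b -> b != c -> a != c ->
     adj a b -> adj b c -> adj a c -> False) ->
  (forall u v, adj u v -> preserving adj adjH u v -> l u != l v ->
     exists w F, cut_side adj [set u; v; w] F) ->
  model adj adjH phi -> forall u v, phi u = phi v -> l u = l v.
Proof.
move=> sadj sadjH c3 c3H notri cut m u v uv; have [_ conn _] := m.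
suff: v \in [set t | l t == l u] by rewrite inE => /eqP.
apply: (conn _ u v) => //; first by rewrite inE.
move=> s t; rewrite !inE => /eqP su st psu ptu; apply: contraT; rewrite -su eq_sym => lst.
have pst : phi s = phi t by rewrite psu.
have [w [F cs]] := cut s t st (ex_intro2 _ _ phi m pst) lst.
have [D csD prD] := exists_preserving_side sadj c3 c3H m st pst cs.
by case: (no_preserving_side sadj c3 notri cut st lst csD prD).
Qed.

(** * Multigraphs: connectivity, contraction and minors *)

Lemma adjacent_sym (G : mgraph) : symmetric (@adjacent G).
Proof. by move=> x y; apply: eq_existsb => e; rewrite /joins orbC. Qed.

Lemma joins_ends (G : mgraph) (e : edge G) : joins e (src e) (tgt e).
Proof. by rewrite /joins !eqxx. Qed.

Lemma joinsP (G : mgraph) (e : edge G) x y :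
  joins e x y -> (src e = x /\ tgt e = y) \/ (src e = y /\ tgt e = x).
Proof. by case/orP=> /andP[/eqP ? /eqP ?]; auto. Qed.

Lemma joinsC (G : mgraph) (e : edge G) x y : joins e x y = joins e y x.
Proof. by rewrite /joins orbC. Qed.

Lemma connectedP (G : mgraph) : connected G <->
  forall (B : {set vertex G}) u v, u \in B ->
    (forall s t, s \in B -> adjacent s t -> t \in B) -> v \in B.
Proof.
split=> [conn B u v uB clB | H u v].
  have /connectP[p pp ->] := conn u v.
  elim: p u uB pp => //= t p IH u uB /andP[ut]; apply: IH; exact: clB ut.
have: v \in [set t | connect (@adjacent G) u t]; last by rewrite inE.
apply: (H _ u); first by rewrite inE.
by move=> s t; rewrite !inE => us st; apply: connect_trans us (connect1 st).
Qed.

Lemma adjacent_remove_vertices (G : mgraph) (X : {set vertex G})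
    (u v : vertex (remove_vertices X)) : adjacent u v = adjacent (val u) (val v).
Proof.
apply/existsP/existsP => [[e ej] | [e ej]].
  by exists (val e); case/joinsP: ej => -[<- <-]; rewrite /joins /= !eqxx ?orbT.
have eX : [&& e \in [set: edge G], src e \in ~: X & tgt e \in ~: X].
  by rewrite inE /=; case/joinsP: ej => -[-> ->]; rewrite ?(valP u) ?(valP v).
by exists (exist _ e eX).
Qed.

Lemma k_connectedP k (G : mgraph) : k_connected k G <->
  forall X D : {set vertex G}, cut_side (@adjacent G) X D -> k <= #|X|.
Proof.
split=> [kc X D [dis D0 DT cl] | H X ltX].
  rewrite leqNgt; apply/negP => /kc/connectedP conn.
  have /subsetPn[t _ tN] : ~~ (setT \subset D :|: X) by rewrite subTset.
  have /set0Pn[d dD] := D0.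
  have dX : d \in ~: X by rewrite inE (disjointFr dis dD).
  have tX : t \in ~: X by move: tN; rewrite !inE negb_or => /andP[].
  have := conn [set u | val u \in D] (exist _ d dX) (exist _ t tX).
  rewrite !inE /= => /(_ dD) K; move: tN; rewrite inE K //.
  move=> s r; rewrite !inE adjacent_remove_vertices => sD /(cl _ _ sD)/setUP[//|].
  by move=> rX; have := valP r; rewrite inE rX.
apply/connectedP => B u v uB clB; apply: contraT => vB.
suff /H : cut_side (@adjacent G) X (val @: B) by rewrite leqNgt ltX.
split.
- rewrite disjoints_subset; apply/subsetP => t /imsetP[s _ ->]; exact: (valP s).
- by apply/set0Pn; exists (val u); apply: imset_f.
- apply/eqP => /setP/(_ (val v)); rewrite in_setT in_setU mem_imset; last exact: val_inj.
  by have := valP v; rewrite in_setC (negbTE vB) => /negbTE->.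
- move=> s t /imsetP[s' sB ->] st; rewrite in_setU.
  case tX: (t \in X); rewrite ?orbT ?orbF //.
  have tC : t \in ~: X by rewrite inE tX.
  apply/imsetP; exists (exist _ t tC) => //.
  by apply: (clB s'); rewrite // adjacent_remove_vertices.
Qed.

Section Contraction.
Variables (G : mgraph) (e : edge G).
Let p : vertex G -> vertex (contract e) := @contract_proj G e.

Lemma contract_proj_surj (t : vertex (contract e)) : exists u, t = p u.
Proof. by case: t => t tP; have /codomP[u E] := tP; exists u; apply: val_inj. Qed.

Lemma contract_projP u v : p u = p v -> u = v \/ joins e u v.
Proof.
case=> /=; rewrite /merge_ends /joins.
case: (u =P tgt e) => [->|_]; case: (v =P tgt e) => [->|_]; auto.
  by move=> ->; right; rewrite !eqxx orbT.
by move=> <-; right; rewrite !eqxx.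
Qed.

Lemma contract_proj_ends : p (src e) = p (tgt e).
Proof. by apply: val_inj; rewrite /= /merge_ends eqxx; case: eqP. Qed.

Lemma contract_proj_joins u v : joins e u v -> p u = p v.
Proof. by case/joinsP=> -[<- <-]; rewrite contract_proj_ends. Qed.

Lemma adjacent_contract u v : adjacent u v -> p u = p v \/ adjacent (p u) (p v).
Proof.
case/existsP=> f; case: (eqVneq f e) => [->|fe] fj; first by left; apply: contract_proj_joins.
right; apply/existsP; exists (exist _ f fe : edge (contract e)).
by case/joinsP: fj => -[<- <-]; rewrite /joins /= !eqxx ?orbT.
Qed.

Lemma adjacent_contract_lift s t : adjacent s t ->
  exists u v, [/\ p u = s, p v = t & adjacent u v].
Proof.
case/existsP=> f /joinsP[] [<- <-].
  exists (src (val f)), (tgt (val f)); split=> //; apply/existsP; exists (val f); exact: joins_ends.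
exists (tgt (val f)), (src (val f)); split=> //; apply/existsP; exists (val f).
by rewrite joinsC joins_ends.
Qed.

(** A cut of G/e with at most two vertices pulls back to a cut of G with at most one vertex more. As
    G is 3-connected, this has exactly three vertices, among them both ends of [e]. *)
Lemma contract_not_three_connected :
  k_connected 3 G -> ~ k_connected 3 (contract e) -> src e != tgt e ->
  exists w F, cut_side (@adjacent G) [set src e; tgt e; w] F.
Proof.
move=> /k_connectedP c3 nc3 nst; apply: NNPP => H; apply: nc3; apply/k_connectedP => X D csX.
rewrite leqNgt; apply/negP => ltX; have [dis D0 DT cl] := csX.
have cs : cut_side (@adjacent G) (p @^-1: X) (p @^-1: D).
  split.
  - rewrite disjoints_subset; apply/subsetP => u; rewrite !inE => uD.
    by rewrite (disjointFr dis uD).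
  - have /set0Pn[d dD] := D0; have [u E] := contract_proj_surj d.
    by apply/set0Pn; exists u; rewrite inE -E.
  - have /subsetPn[t _ tN] : ~~ (setT \subset D :|: X) by rewrite subTset.
    have [u E] := contract_proj_surj t; apply/eqP => /setP/(_ u).
    by move: tN; rewrite E !inE => /negbTE->.
  - move=> u v; rewrite !inE => uD /adjacent_contract[<-|/(cl _ _ uD)]; first by rewrite uD.
    by rewrite inE.
have le3 := c3 _ _ cs.
(* The projection is injective away from [tgt e]. *)
have lep : #|(p @^-1: X) :\ tgt e| <= #|X|.
  rewrite -(card_in_imset (f := p)).
    by apply: subset_leq_card; apply/subsetP => t /imsetP[u]; rewrite !inE => /andP[_ uX] ->.
  move=> u v; rewrite !inE => /andP[ut _] /andP[vt _] /contract_projP[//|].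
  by case/joinsP=> -[E1 E2]; [rewrite -E2 eqxx in vt | rewrite -E2 eqxx in ut].
have le2 := leq_trans lep ltX.
move: le3; rewrite (cardsD1 (tgt e)); case tX: (tgt e \in _); last first.
  by rewrite add0n => /leq_trans/(_ lep); rewrite leqNgt ltX.
rewrite add1n => le3.
have sX : src e \in (p @^-1: X) :\ tgt e.
  by rewrite !inE nst contract_proj_ends; move: tX; rewrite inE.
have : #|(p @^-1: X) :\ tgt e :\ src e| == 1.
  move: le2 le3; rewrite (cardsD1 (src e)) sX add1n !ltnS => le1 ge1.
  by rewrite eqn_leq le1 ge1.
case/cards1P=> w Ew; apply: H; exists w, (p @^-1: D).
suff -> : [set src e; tgt e; w] = p @^-1: X by [].
apply/setP => t; rewrite in_setU -Ew !in_setD1 !in_set2.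
case: (eqVneq t (src e)) => [->|_] /=; first by move: sX; rewrite in_setD1 => /andP[_ ->].
by case: (eqVneq t (tgt e)) => [->|_] /=; rewrite ?tX.
Qed.
End Contraction.

Definition graph_partial_model (H G : mgraph) :=
  partial_model (@adjacent G) (@adjacent H).
Definition graph_model (H G : mgraph) := model (@adjacent G) (@adjacent H).

Lemma isomorphic_partial_model (H G : mgraph) : isomorphic H G ->
  exists psi, @graph_partial_model H G psi.
Proof.
case=> f [g [[f' fK f'K] gb gj]]; exists (fun t => Some (f' t)); split.
- by move=> a; exists (f a); rewrite fK.
- by move=> B a u v uB [ua] [va] _; rewrite (can_inj f'K (etrans va (esym ua))).
- move=> a b _ /existsP[e ej]; exists (f a), (f b); split; rewrite ?fK //.
  apply/existsP; exists (g e); have := gj e.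
  by case/joinsP: ej => -[<- <-] //; rewrite joinsC.
Qed.

Lemma adjacent_subgraph (G : mgraph) W F (s t : vertex (@subgraph G W F)) :
  adjacent s t -> adjacent (val s) (val t).
Proof.
case/existsP=> e ej; apply/existsP; exists (val e).
by case/joinsP: ej => -[<- <-]; rewrite /joins /= !eqxx ?orbT.
Qed.

Lemma subgraph_partial_model (H G : mgraph) W F psi :
  @graph_partial_model H (@subgraph G W F) psi ->
  exists psi', @graph_partial_model H G psi'.
Proof.
move=> [surj conn edges].
pose psi' t := obind psi (insub t : option (vertex (@subgraph G W F))).
have psi'E t : psi' (val t) = psi t by rewrite /psi' valK.
have psi'S t a : psi' t = Some a -> exists2 t', t = val t' & psi t' = Some a.
  by rewrite /psi'; case: insubP => //= t' _ <-; exists t'.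
exists psi'; split.
- by move=> a; have [u ua] := surj a; exists (val u); rewrite psi'E.
- move=> B a u0 v0 uB /psi'S[u Eu ua] /psi'S[v Ev va] clB; subst u0 v0.
  suff: v \in [set t | val t \in B] by rewrite inE.
  apply: (conn _ a u) => //; first by rewrite inE.
  move=> s t; rewrite !inE => sB st sa ta.
  by apply: (clB (val s)); rewrite ?psi'E //; apply: adjacent_subgraph.
- move=> a b ab /(edges a b ab)[u [v [ua vb uv]]].
  by exists (val u), (val v); rewrite !psi'E; split=> //; apply: adjacent_subgraph.
Qed.

Lemma contract_partial_model (H G : mgraph) (e : edge G) psi :
  @graph_partial_model H (contract e) psi ->
  exists psi', @graph_partial_model H G psi'.
Proof.
move=> [surj conn edges]; pose p : vertex G -> vertex (contract e) := @contract_proj G e.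
have same u v : p u = p v -> u = v \/ adjacent u v.
  by case/contract_projP=> [->|uv]; auto; right; apply/existsP; exists e.
exists (psi \o p); split=> /=.
- by move=> a; have [t ta] := surj a; have [u E] := contract_proj_surj t; exists u; rewrite -ta E.
- move=> B a u v uB ua va clB.
  have sat s t : s \in B -> p s = p t -> psi (p s) = Some a -> t \in B.
    move=> sB st sa; have [<-//|adj_st] := same s t st.
    by apply: (clB s t) => //; rewrite -st.
  suff: p v \in p @: B by case/imsetP=> s sB E; apply: (sat s); rewrite -?E.
  apply: (conn _ a (p u)) => //; first exact: imset_f.
  move=> s t /imsetP[s' sB Es] /adjacent_contract_lift[x [y [xs yt xy]]] sa ta.
  rewrite -yt; apply: imset_f; apply: (clB x y) => //.
  + by apply: (sat s'); rewrite -?Es.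
  + by rewrite /p xs.
  + by rewrite /p yt.
- move=> a b ab /(edges a b ab)[s [t [sa tb /adjacent_contract_lift[u [v [us vt uv]]]]]].
  by exists u, v; rewrite /p us vt.
Qed.

(** Models pull back through every minor operation; they become partial because a subgraph may drop
    vertices. *)
Lemma minor_partial_model (H G : mgraph) : minor H G ->
  exists psi, @graph_partial_model H G psi.
Proof.
elim=> {G} [G|G W F _ [psi]|G e _ [psi]].
- exact: isomorphic_partial_model.
- exact: subgraph_partial_model.
- exact: contract_partial_model.
Qed.

Lemma model_contract (H G : mgraph) (e : edge G) phi :
  @graph_model H G phi -> phi (src e) = phi (tgt e) ->
  @graph_model H (contract e) (fun t => phi (val t)).
Proof.
move=> [surj conn edges] Ee; pose p : vertex G -> vertex (contract e) := @contract_proj G e.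
have pE u : phi (val (p u)) = phi u.
  by rewrite /= /merge_ends; case: eqP => // ->.
split.
- by move=> a; have [u ua] := surj a; exists (p u); rewrite pE.
- move=> B s t sB; have [u Eu] := contract_proj_surj s; have [v Ev] := contract_proj_surj t.
  rewrite {}Eu {}Ev !pE in sB * => vu clB.
  suff: v \in p @^-1: B by rewrite inE.
  apply: (conn _ u) => //; first by rewrite inE.
  move=> x y; rewrite !inE => xB xy xu yu.
  have [pxy|pxy] : p x = p y \/ adjacent (p x) (p y) by exact: adjacent_contract.
    by rewrite -pxy.
  by apply: (clB (p x)); rewrite ?pE.
- move=> a b ab adj_ab; have [u [v [ua vb uv]]] := edges a b ab adj_ab.
  exists (p u), (p v); rewrite !pE; split=> //.
  have [puv|//] : p u = p v \/ adjacent (p u) (p v) by exact: adjacent_contract.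
  by have := pE u; rewrite puv pE ua vb => E; rewrite E eqxx in ab.
Qed.

(** Choosing one edge of G for each edge of H gives a spanning subgraph isomorphic to H; simplicity
    makes the choices distinct. *)
Lemma injective_model_minor (H G : mgraph) phi : simple_graph H ->
  @graph_model H G phi -> injective phi -> minor H G.
Proof.
move=> [noloop nopar] [surj conn edges] inj.
have [h phiK] : exists h, cancel h phi.
  have ex a : exists u, phi u == a by have [u <-] := surj a; exists u.
  by exists (fun a => xchoose (ex a)) => a; apply/eqP; apply: (xchooseP (ex a)).
have phiK' : cancel phi h by move=> u; apply: inj; rewrite phiK.
have ex (e : edge H) : exists f : edge G, joins f (h (src e)) (h (tgt e)).
  have ae : adjacent (src e) (tgt e) by apply/existsP; exists e; apply: joins_ends.
  have [u [v [us vt /existsP[f fj]]]] := edges _ _ (noloop e) ae.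
  by exists f; rewrite -us -vt !phiK'.
pose g e := xchoose (ex e).
have gP e : joins (g e) (h (src e)) (h (tgt e)) by exact: xchooseP (ex e).
have g_inj : injective g.
  move=> e f E; apply: (nopar e f (src f) (tgt f)); last exact: joins_ends.
  have h_inj := can_inj phiK; have := gP f; rewrite -E => /joinsP[] [E1 E2];
    case/joinsP: (gP e) => -[E3 E4].
  - by rewrite /joins (h_inj _ _ (etrans (esym E3) E1)) (h_inj _ _ (etrans (esym E4) E2)) !eqxx.
  - by rewrite /joins (h_inj _ _ (etrans (esym E4) E2)) (h_inj _ _ (etrans (esym E3) E1)) !eqxx orbT.
  - by rewrite /joins (h_inj _ _ (etrans (esym E3) E1)) (h_inj _ _ (etrans (esym E4) E2)) !eqxx orbT.
  - by rewrite /joins (h_inj _ _ (etrans (esym E4) E2)) (h_inj _ _ (etrans (esym E3) E1)) !eqxx.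
apply: (@MinorSub H G setT [set g e | e : edge H]); apply: MinorIso.
pose f a : vertex (subgraph setT [set g e | e : edge H]) := exist _ (h a) (in_setT (h a)).
have gS e : [&& g e \in [set g e | e : edge H], src (g e) \in setT & tgt (g e) \in setT].
  by rewrite imset_f ?in_setT.
exists f, (fun e => exist _ (g e) (gS e)); split.
- exists (phi \o val) => [a|u /=]; first exact: phiK.
  by apply: val_inj; rewrite /= phiK'.
- apply: inj_card_bij => [e e' /(congr1 val)|]; first exact: g_inj.
  rewrite -(card_imset predT g_inj) card_sig; apply: subset_leq_card.
  apply/subsetP => e; rewrite inE => /andP[/imsetP[e' _ ->] _]; exact: imset_f.
- by move=> e; case/joinsP: (gP e) => -[E1 E2]; rewrite /joins -!(inj_eq val_inj) /= E1 E2 !eqxx ?orbT.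
Qed.

(** Non-loop edges inside fibres are contracted one at a time. Once none is left, connected fibres
    are single vertices. *)
Lemma model_minor (H G : mgraph) phi : simple_graph H -> @graph_model H G phi -> minor H G.
Proof.
move=> sH; have [n] := ubnP #|vertex G|; elim: n G phi => // n IH G phi leG m.
case: (boolP [exists e : edge G, (src e != tgt e) && (phi (src e) == phi (tgt e))]).
  case/existsP=> e /andP[nst /eqP Ee]; apply: (MinorContract (e := e)).
  apply: IH (model_contract m Ee); rewrite -ltnS; apply: leq_trans leG; rewrite ltnS.
  rewrite card_sig -cardsT; apply: proper_card; apply/properP; split.
    by apply/subsetP => t _; rewrite inE.
  exists (tgt e); rewrite ?inE //; apply/negP => /codomP[t].
  rewrite /merge_ends; case: eqP => [_ E|ne E]; last by rewrite E in ne.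
  by rewrite E eqxx in nst.
move/existsPn=> noe; apply: (injective_model_minor sH m) => u v uv.
have [_ conn _] := m; apply/esym/set1P; apply: (conn _ u v) => //; first exact: set11.
move=> s t /set1P-> /existsP[e ej] _ tu; rewrite inE eq_sym.
have := noe e; rewrite negb_and negbK; case/joinsP: ej => -[-> ->]; rewrite tu eqxx orbF //.
by rewrite eq_sym.
Qed.

Lemma minor_model (H G : mgraph) : k_connected 3 G -> 0 < #|vertex H| -> minor H G ->
  exists phi, @graph_model H G phi.
Proof.
move=> /k_connectedP c3 H0 /minor_partial_model[psi].
exact: (partial_model_extend (@adjacent_sym G) c3 H0).
Qed.

(** * The forest *)

(** Stated with cycles of G itself, so that [F] can grow without changing the ambient graph. *)
Definition acyclic_edges (G : mgraph) (F : {set edge G}) :=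
  forall n (v : 'I_n -> vertex G) (e : 'I_n -> edge G), 0 < n ->
    injective v -> injective e -> (forall i, joins (e i) (v i) (v (ordS i))) ->
    exists i, e i \notin F.

Lemma acyclic_forest (G : mgraph) (F : {set edge G}) :
  acyclic_edges F -> forest (subgraph setT F).
Proof.
move=> acF n n0 [v [e [vi ei ej]]].
have [|||i /negP[]] := acF n (fun i => val (v i)) (fun i => val (e i)) n0.
- by move=> i j /val_inj/vi.
- by move=> i j /val_inj/ei.
- by move=> i; case/joinsP: (ej i) => -[<- <-]; rewrite /joins /= !eqxx ?orbT.
- by case/and3P: (valP (e i)).
Qed.

(* A cycle leaves each label class as often as it enters it. *)
Lemma acyclic_add (G : mgraph) (L : eqType) (l : vertex G -> L) (F : {set edge G}) f :
  acyclic_edges F -> (forall e, e \in F -> l (src e) = l (tgt e)) ->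
  l (src f) != l (tgt f) -> acyclic_edges (f |: F).
Proof.
move=> acF lF lf n v e n0 vi ei ej.
case: (boolP [exists i, e i == f]) => [/existsP[i /eqP Ei]|/existsPn H]; last first.
  have [i iF] := acF n v e n0 vi ei ej; exists i.
  by rewrite !inE negb_or H iF.
apply/existsP; apply: contraT => /existsPn H.
have step j : j != i -> l (v (ordS j)) = l (v j).
  move=> ji; have := H j; rewrite negbK !inE -Ei (inj_eq ei) (negbTE ji) /= => /lF.
  by case/joinsP: (ej j) => -[-> ->].
have lvi : l (v (ordS i)) != l (v i).
  by move: lf; rewrite -Ei; case/joinsP: (ej i) => -[-> ->]; rewrite // eq_sym.
have: \sum_j (l (v j) == l (v i)) = \sum_j (l (v (ordS j)) == l (v i)).
  by rewrite (reindex_inj (@ordS_inj n)).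
rewrite (bigD1 i) //= [in RHS](bigD1 i) //= eqxx (negbTE lvi).
rewrite [in RHS](eq_bigr (fun j => (l (v j) == l (v i)) : nat)); first by
  move/eqP; rewrite -[X in _ == X]add0n eqn_add2r.
by move=> j /step->.
Qed.

Lemma triangle (G : mgraph) (a b c : vertex G) e1 e2 e3 :
  a != b -> b != c -> a != c ->
  joins e1 a b -> joins e2 b c -> joins e3 a c -> has_cycle G 3.
Proof.
move=> ab bc ac j1 j2 j3.
have neq e f x y z : joins e x y -> joins f x z -> y != z -> e != f :> edge G.
  move=> /joinsP je /joinsP jf; apply: contraNneq => ef; rewrite -ef in jf.
  by apply/eqP; case: je jf => -[] ? ? [] [] ? ?; congruence.
exists (fun i => nth a [:: a; b; c] i), (fun i => nth e1 [:: e1; e2; e3] i); split.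
- move=> i j /eqP; rewrite nth_uniq //=; first by move/eqP/val_inj.
  by rewrite !inE negb_or ab ac bc.
- move=> i j /eqP; rewrite nth_uniq //=; first by move/eqP/val_inj.
  have [j1' j2' j3'] : [/\ joins e1 b a, joins e2 c b & joins e3 c a].
    by split; rewrite joinsC.
  rewrite !inE negb_or (neq e1 e3 a b c) // (neq e1 e2 b a c) //.
  by rewrite (neq e2 e3 c b a) // eq_sym.
- by case=> [[|[|[|i]]] lti] //=; rewrite joinsC.
Qed.

Lemma contractible_edge_between (G H : mgraph) (phi : vertex G -> vertex H)
    (L : eqType) (l : vertex G -> L) u v :
  triangle_free G -> k_connected 3 G -> k_connected 3 H -> simple_graph H ->
  graph_model phi -> phi u = phi v -> l u != l v ->
  exists2 e, contractible H e & l (src e) != l (tgt e).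
Proof.
move=> tf c3 c3H sH m uv luv; apply: NNPP => none.
have {none} noe e : contractible H e -> l (src e) = l (tgt e).
  by move=> ce; apply/eqP; apply: contra_notT none => le; exists e.
move/eqP: luv; apply; apply: (label_constant_on_fibres (@adjacent_sym G)
  (@adjacent_sym H) _ _ _ _ m uv); try by [move/k_connectedP: c3|move/k_connectedP: c3H].
- move=> a b c ab bc ac /existsP[e1 j1] /existsP[e2 j2] /existsP[e3 j3]; apply: tf.
  exact: (triangle ab bc ac j1 j2 j3).
- move=> a b /existsP[e ej] [psi mpsi Epsi] lab.
  have ab : a != b by apply: contraNneq lab => ->.
  have Ee : psi (src e) = psi (tgt e) by case/joinsP: ej => -[-> ->].
  have le : l (src e) != l (tgt e) by case/joinsP: ej => -[-> ->] //; rewrite eq_sym.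
  have mc : minor H (contract e) := model_minor sH (model_contract mpsi Ee).
  have nst : src e != tgt e by apply: contraNneq le => ->.
  have [c3e|w [F cs]] := @contract_not_three_connected G e c3 _ nst.
    by move/eqP: le; apply; apply: noe.
  exists w, F; suff -> : [set a; b] = [set src e; tgt e] by [].
  by case/joinsP: ej => -[-> ->] //; rewrite setUC.
Qed.

(** Greedy construction: [l] names the components of the forest, and each added edge costs at most
    one label. Without an edge to add, each of the |H| fibres would carry a single label,
    contradicting the count in the last clause. *)
Lemma contractible_forest (G H : mgraph) (phi : vertex G -> vertex H) k :
  triangle_free G -> k_connected 3 G -> k_connected 3 H -> simple_graph H ->
  graph_model phi -> #|vertex H| + k <= #|vertex G| ->
  exists (F : {set edge G}) (l : vertex G -> vertex G),
    [/\ #|F| = k, acyclic_edges F, forall e, e \in F -> contractible H e,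
        forall e, e \in F -> l (src e) = l (tgt e)
      & #|vertex G| <= #|codom l| + k].
Proof.
move=> tf c3 c3H sH m; elim: k => [|k IH] leG.
  exists set0, id; split=> //; rewrite ?cards0 //.
  - move=> n v e n0 _ _ _; exists (Ordinal n0); by rewrite inE.
  - by move=> e; rewrite inE.
  - by move=> e; rewrite inE.
  - by rewrite addn0 card_codom.
have [|F [l [cF acF ctF lF lk]]] := IH; first by apply: leq_trans leG; rewrite addnS.
have [e ce le] : exists2 e, contractible H e & l (src e) != l (tgt e).
  case: (boolP [exists u, exists v, (phi u == phi v) && (l u != l v)]).
    case/existsP=> u /existsP[v /andP[/eqP uv luv]].
    exact: (contractible_edge_between tf c3 c3H sH m uv luv).
  move/existsPn=> none; exfalso.
  have lphi u v : phi u = phi v -> l u = l v.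
    by move=> uv; move/existsPn: (none u) => /(_ v); rewrite uv eqxx negbK => /eqP.
  have [surj _ _] := m.
  have ex a : exists u, phi u == a by have [u <-] := surj a; exists u.
  have : #|codom l| <= #|vertex H|.
    apply: leq_trans (leq_image_card (fun a => l (xchoose (ex a))) _).
    apply: subset_leq_card; apply/subsetP => t /codomP[u ->].
    apply/imageP; exists (phi u) => //; apply: lphi; symmetry.
    by apply/eqP; apply: (xchooseP (ex (phi u))).
  rewrite -(leq_add2r k) => /(leq_trans lk); rewrite leqNgt.
  by rewrite -addnS leG.
have eF : e \notin F by apply: contraNN le => /lF->.
pose l' t := if l t == l (tgt e) then l (src e) else l t.
exists (e |: F), l'; split.
- by rewrite cardsU1 eF cF.
- exact: acyclic_add acF lF le.
- by move=> f /setU1P[->|/ctF].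
- by move=> f /setU1P[->|/lF lf]; rewrite /l' ?lf // eqxx; case: eqP.
- apply: leq_trans lk _; rewrite addnS -addSn leq_add2r.
  rewrite [#|codom l|](cardD1 (l (tgt e))) codom_f add1n ltnS.
  apply: subset_leq_card; apply/subsetP => t; rewrite inE => /andP[tl /codomP[u Eu]].
  by apply/codomP; exists u; rewrite /l' -Eu (negbTE tl).
Qed.

Theorem theorem5 (G H : mgraph) :
  triangle_free G -> k_connected 3 G ->
  k_connected 3 H -> simple_graph H -> minor H G ->
  1 <= nb_vertices H ->
  exists (W : {set vertex G}) (F : {set edge G}),
    [/\ forest (subgraph W F),
        #|edge (subgraph W F)| = nb_vertices G - nb_vertices H
      & forall e : edge (subgraph W F), contractible H (val e)].
Proof.
move=> tf c3 c3H sH mHG H1; have [phi m] := minor_model c3 H1 mHG.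
have [surj _ _] := m.
(* The model is onto, so the truncated subtraction |G| - |H| is a genuine one. *)
have leHG : #|vertex H| <= #|vertex G|.
  apply: leq_trans (leq_image_card phi predT); apply: subset_leq_card.
  by apply/subsetP => a _; have [u <-] := surj a; apply: codom_f.
have [|F [l [cF acF ctF _ _]]] := contractible_forest (k := #|vertex G| - #|vertex H|) tf c3 c3H sH m.
  by rewrite subnKC.
exists setT, F; split; first exact: acyclic_forest.
- rewrite card_sig -cF; apply: eq_card => e; by rewrite unfold_in !in_setT !andbT.
- by move=> e; apply: ctF; case/and3P: (valP e).
Qed.
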